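(* Let $q\in\mathbb{K}\setminus\{0\}$ with $q\neq-1,1$ and let $d\in\mathbb{Z}$ with $q^d=1$. The homogeneous averaging operators $P_d^1,\dots,P_d^5$ with degree $d$ on the $q$-deformed $W(2,2)$ Hom-algebra $\mathcal{W}^q$ (listed in the context) provide, via $\{x,y\}^i=[P_d^i(x),y]$, the following Hom-Leibniz algebras $(\mathcal{W}^q,\{\cdot,\cdot\}^i,\alpha)$ on the underlying linear space $\mathcal{W}^q$: for all $m,n\in\mathbb{Z}$, writing $\delta=\delta_{q^{2m},1}$, (i) $\{L_m,L_n\}^1=\nu_1\delta[m-n]L_{m+n}+(\nu_3\delta+\gamma)[m-n]W_{m+n}$, $\{L_m,W_n\}^1=\nu_1\delta[m-n]W_{m+n}$, $\{W_m,L_n\}^1=\nu_2\delta[m-n]L_{m+n}+\nu_4\delta[m-n]W_{m+n}$, $\{W_m,W_n\}^1=\nu_2\delta[m-n]W_{m+n}$; (ii) $\{L_m,L_n\}^2=(\nu_1\delta+\beta)[m-n]L_{m+n}+(\nu_3\delta+\gamma)[m-n]W_{m+n}$, $\{L_m,W_n\}^2=(\nu_1\delta+\beta)[m-n]W_{m+n}$, $\{W_m,L_n\}^2=\nu_2\delta[m-n]L_{m+n}+\nu_4\delta[m-n]W_{m+n}$, $\{W_m,W_n\}^2=\nu_2\delta[m-n]W_{m+n}$; (iii) $\{L_m,L_n\}^3=(\nu_1\delta+\beta)[m-n]L_{m+n}+\nu_3\delta[m-n]W_{m+n}$, $\{L_m,W_n\}^3=(\nu_1\delta+\beta)[m-n]W_{m+n}$,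 $\{W_m,L_n\}^3=\nu_2\delta[m-n]L_{m+n}+(\nu_4\delta+\beta)[m-n]W_{m+n}$, $\{W_m,W_n\}^3=\nu_2\delta[m-n]W_{m+n}$; (iv) $\{L_m,L_n\}^4=(\nu_1\delta+\gamma)[m-n]L_{m+n}+\nu_3\delta[m-n]W_{m+n}$, $\{L_m,W_n\}^4=(\nu_1\delta+\gamma)[m-n]W_{m+n}$, $\{W_m,L_n\}^4=\nu_2\delta[m-n]L_{m+n}+(\nu_4\delta+\beta)[m-n]W_{m+n}$, $\{W_m,W_n\}^4=\nu_2\delta[m-n]W_{m+n}$; (v) $\{L_m,L_n\}^5=(\nu_1\delta+\gamma)[m-n]L_{m+n}+\big(\nu_3\delta+\frac{\gamma\theta-\gamma^2}{\beta}\big)[m-n]W_{m+n}$, $\{L_m,W_n\}^5=(\nu_1\delta+\gamma)[m-n]W_{m+n}$, $\{W_m,L_n\}^5=(\nu_2\delta+\beta)[m-n]L_{m+n}+(\nu_4\delta+\theta-\gamma)[m-n]W_{m+n}$, $\{W_m,W_n\}^5=(\nu_2\delta+\beta)[m-n]W_{m+n}$; where $\nu_1,\nu_2,\nu_3,\nu_4,\gamma,\theta\in\mathbb{K}$ and $\beta\in\mathbb{K}\setminus\{0\}$.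
   Context: $\mathbb{K}$ is a field of characteristic zero. For $q\in\mathbb{K}\setminus\{0,1,-1\}$ and $n\in\mathbb{Z}$ put $[n]=\frac{q^n-q^{-n}}{q-q^{-1}}$. The $q$-deformed $W(2,2)$ Hom-algebra $(\mathcal{W}^q,[\cdot,\cdot],\alpha)$ is the $\mathbb{K}$-vector space with basis $\{L_n,W_n\mid n\in\mathbb{Z}\}$, with the skew-symmetric bilinear product determined by $[L_m,L_n]=[m-n]L_{m+n}$, $[L_m,W_n]=[m-n]W_{m+n}$, $[W_m,W_n]=0$, and with the linear map $\alpha(L_n)=(q^n+q^{-n})L_n$, $\alpha(W_n)=(q^n+q^{-n})W_n$. It is $\mathbb{Z}$-graded with $\mathcal{W}^q_n=\mathrm{span}_{\mathbb{K}}\{L_n,W_n\}$. An averaging operator on a Hom-algebra $(A,[\cdot,\cdot],\alpha)$ (a vector space with a bilinear product and a linear map $\alpha:A\to A$) is a linear map $P:A\to A$ with $\alpha\circ P=P\circ\alpha$ and $[P(x),P(y)]=P([P(x),y])=P([x,P(y)])$ for all $x,y\in A$. An operator $P$ on $\mathcal{W}^q$ is homogeneous with degree $d$ if $P(\mathcal{W}^q_m)\subseteq\mathcal{W}^q_{m+d}$ for all $m\in\mathbb{Z}$. A Hom-Leibniz algebra is a Hom-algebra $(A,\{\cdot,\cdot\},\alpha)$ with $\{\alpha(x),\{y,z\}\}=\{\{x,y\},\alpha(z)\}+\{\alpha(y),\{x,z\}\}$ for all $x,y,z\in A$. $\delta_{x,y}=1$ if $x=y$ and $0$ otherwise. The operators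 $P_d^1,\dots,P_d^5$ are given, for all $m\in\mathbb{Z}$, with $\delta=\delta_{q^{2m},1}$, by: $P_d^1(L_m)=\nu_1\delta L_{m+d}+(\nu_3\delta+\gamma)W_{m+d}$, $P_d^1(W_m)=\nu_2\delta L_{m+d}+\nu_4\delta W_{m+d}$; $P_d^2(L_m)=(\nu_1\delta+\beta)L_{m+d}+(\nu_3\delta+\gamma)W_{m+d}$, $P_d^2(W_m)=\nu_2\delta L_{m+d}+\nu_4\delta W_{m+d}$; $P_d^3(L_m)=(\nu_1\delta+\beta)L_{m+d}+\nu_3\delta W_{m+d}$, $P_d^3(W_m)=\nu_2\delta L_{m+d}+(\nu_4\delta+\beta)W_{m+d}$; $P_d^4(L_m)=(\nu_1\delta+\gamma)L_{m+d}+\nu_3\delta W_{m+d}$, $P_d^4(W_m)=\nu_2\delta L_{m+d}+(\nu_4\delta+\beta)W_{m+d}$; $P_d^5(L_m)=(\nu_1\delta+\gamma)L_{m+d}+\big(\nu_3\delta+\frac{\gamma\theta-\gamma^2}{\beta}\big)W_{m+d}$, $P_d^5(W_m)=(\nu_2\delta+\beta)L_{m+d}+(\nu_4\delta+\theta-\gamma)W_{m+d}$; with $\nu_1,\nu_2,\nu_3,\nu_4,\gamma,\theta\in\mathbb{K}$ and $\beta\in\mathbb{K}\setminus\{0\}$.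
   Formalization: The Hom-Leibniz conclusion is asserted only for parameters where P_d^i is an averaging operator (it fails otherwise, e.g. P^1 with γν₁≠0); products of [P_d^i(x),y] are placed in degree m+n+d, the printed degree m+n table being treated as a separate bilinear bracket. *)

(* Defs.v *)
From mathcomp Require Import all_boot all_order all_algebra.
From mathcomp Require Import finmap.
From mathcomp.multinomials Require Import monalg.

Set Implicit Arguments.
Unset Strict Implicit.
Unset Printing Implicit Defensive.

Import GRing.Theory.
Local Open Scope ring_scope.

Section HomAlgebra.
Variables (K : fieldType) (A : lmodType K).
Implicit Types (br : A -> A -> A) (alpha P : A -> A).

Definition hom_algebra br alpha : Prop :=
  [/\ forall y, linear (fun x => br x y),
      forall x, linear (br x)
    & linear alpha].

Definition averaging_operator br alpha P : Prop :=
  [/\ linear P,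
      forall x, alpha (P x) = P (alpha x),
      forall x y, br (P x) (P y) = P (br (P x) y)
    & forall x y, br (P x) (P y) = P (br x (P y))].

Definition hom_Leibniz_algebra br alpha : Prop :=
  hom_algebra br alpha /\
  forall x y z,
    br (alpha x) (br y z) = br (br x y) (alpha z) + br (alpha y) (br x z).

End HomAlgebra.

(* [inl n] indexes L_n and [inr n] indexes W_n. *)
Notation Windex := (int + int)%type.

Section W22.
Variable K : fieldType.

(* The free K-vector space on the indices: finitely supported functions. *)
Definition Wspace : lmodType K := {malg K[Windex]}.

Definition L (n : int) : Wspace := << inl n >>.
Definition W (n : int) : Wspace := << inr n >>.

Definition lin_ext (f : Windex -> Wspace) (x : Wspace) : Wspace :=
  \sum_(k <- msupp x) x@_k *: f k.

Definition bilin_ext (f : Windex -> Windex -> Wspace) (x y : Wspace) : Wspace :=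
  lin_ext (fun k => lin_ext (f k) y) x.

Definition Wcomponent (n : int) (x : Wspace) : Prop :=
  exists a b : K, x = a *: L n + b *: W n.

Definition homogeneous (d : int) (P : Wspace -> Wspace) : Prop :=
  forall m x, Wcomponent m x -> Wcomponent (m + d) (P x).

Variable q : K.

Definition qint (n : int) : K := (q ^ n - q ^ (- n)) / (q - q^-1).

Definition Wbracket_basis (k l : Windex) : Wspace :=
  match k, l with
  | inl m, inl n => qint (m - n) *: L (m + n)
  | inl m, inr n => qint (m - n) *: W (m + n)
  | inr m, inl n => - (qint (n - m) *: W (n + m))
  | inr _, inr _ => 0
  end.

Definition Wbracket : Wspace -> Wspace -> Wspace := bilin_ext Wbracket_basis.

Definition Walpha : Wspace -> Wspace :=
  lin_ext (fun k => match k with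
                    | inl n => (q ^ n + q ^ (- n)) *: L n
                    | inr n => (q ^ n + q ^ (- n)) *: W n
                    end).

Definition delta (m : int) : K := (q ^ (2 * m) == 1)%:R.

Definition basis_op (d : int) (a b c e : int -> K) : Wspace -> Wspace :=
  lin_ext (fun k => match k with
                    | inl m => a m *: L (m + d) + b m *: W (m + d)
                    | inr m => c m *: L (m + d) + e m *: W (m + d)
                    end).

Variables nu1 nu2 nu3 nu4 : K.

(* The averaging identities do not hold for all values of the parameters: for
   P1 they force gamma * nu1 = 0 (take x = L_1, y = L_0). *)

Definition P1 (gamma : K) (d : int) : Wspace -> Wspace :=
  basis_op d (fun m => nu1 * delta m) (fun m => nu3 * delta m + gamma)
             (fun m => nu2 * delta m) (fun m => nu4 * delta m).

Definition P2 (beta gamma : K) (d : int) : Wspace -> Wspace :=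
  basis_op d (fun m => nu1 * delta m + beta) (fun m => nu3 * delta m + gamma)
             (fun m => nu2 * delta m) (fun m => nu4 * delta m).

Definition P3 (beta : K) (d : int) : Wspace -> Wspace :=
  basis_op d (fun m => nu1 * delta m + beta) (fun m => nu3 * delta m)
             (fun m => nu2 * delta m) (fun m => nu4 * delta m + beta).

Definition P4 (beta gamma : K) (d : int) : Wspace -> Wspace :=
  basis_op d (fun m => nu1 * delta m + gamma) (fun m => nu3 * delta m)
             (fun m => nu2 * delta m) (fun m => nu4 * delta m + beta).

Definition P5 (beta gamma theta : K) (d : int) : Wspace -> Wspace :=
  basis_op d (fun m => nu1 * delta m + gamma)
             (fun m => nu3 * delta m + (gamma * theta - gamma ^+ 2) / beta)
             (fun m => nu2 * delta m + beta)
             (fun m => nu4 * delta m + theta - gamma).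

(* In the multiplication tables below the products of degree-m and degree-n
   basis vectors lie in degree m + n + s.  The bracket [P_d x, y] has shift
   s = d; shift s = 0 gives products in degree m + n.  No shift appears in
   [m - n], since [m + d - n] = [m - n] when q^d = 1. *)

Definition table1 (gamma : K) (s : int) (br : Wspace -> Wspace -> Wspace) : Prop :=
  forall m n : int,
  [/\ br (L m) (L n) = (nu1 * delta m * qint (m - n)) *: L (m + n + s)
        + ((nu3 * delta m + gamma) * qint (m - n)) *: W (m + n + s),
      br (L m) (W n) = (nu1 * delta m * qint (m - n)) *: W (m + n + s),
      br (W m) (L n) = (nu2 * delta m * qint (m - n)) *: L (m + n + s)
        + (nu4 * delta m * qint (m - n)) *: W (m + n + s)
    & br (W m) (W n) = (nu2 * delta m * qint (m - n)) *: W (m + n + s)].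

Definition table2 (beta gamma : K) (s : int) (br : Wspace -> Wspace -> Wspace)
    : Prop :=
  forall m n : int,
  [/\ br (L m) (L n) = ((nu1 * delta m + beta) * qint (m - n)) *: L (m + n + s)
        + ((nu3 * delta m + gamma) * qint (m - n)) *: W (m + n + s),
      br (L m) (W n) = ((nu1 * delta m + beta) * qint (m - n)) *: W (m + n + s),
      br (W m) (L n) = (nu2 * delta m * qint (m - n)) *: L (m + n + s)
        + (nu4 * delta m * qint (m - n)) *: W (m + n + s)
    & br (W m) (W n) = (nu2 * delta m * qint (m - n)) *: W (m + n + s)].

Definition table3 (beta : K) (s : int) (br : Wspace -> Wspace -> Wspace) : Prop :=
  forall m n : int,
  [/\ br (L m) (L n) = ((nu1 * delta m + beta) * qint (m - n)) *: L (m + n + s)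
        + (nu3 * delta m * qint (m - n)) *: W (m + n + s),
      br (L m) (W n) = ((nu1 * delta m + beta) * qint (m - n)) *: W (m + n + s),
      br (W m) (L n) = (nu2 * delta m * qint (m - n)) *: L (m + n + s)
        + ((nu4 * delta m + beta) * qint (m - n)) *: W (m + n + s)
    & br (W m) (W n) = (nu2 * delta m * qint (m - n)) *: W (m + n + s)].

Definition table4 (beta gamma : K) (s : int) (br : Wspace -> Wspace -> Wspace)
    : Prop :=
  forall m n : int,
  [/\ br (L m) (L n) = ((nu1 * delta m + gamma) * qint (m - n)) *: L (m + n + s)
        + (nu3 * delta m * qint (m - n)) *: W (m + n + s),
      br (L m) (W n) = ((nu1 * delta m + gamma) * qint (m - n)) *: W (m + n + s),
      br (W m) (L n) = (nu2 * delta m * qint (m - n)) *: L (m + n + s)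
        + ((nu4 * delta m + beta) * qint (m - n)) *: W (m + n + s)
    & br (W m) (W n) = (nu2 * delta m * qint (m - n)) *: W (m + n + s)].

Definition table5 (beta gamma theta : K) (s : int)
    (br : Wspace -> Wspace -> Wspace) : Prop :=
  forall m n : int,
  [/\ br (L m) (L n) = ((nu1 * delta m + gamma) * qint (m - n)) *: L (m + n + s)
        + ((nu3 * delta m + (gamma * theta - gamma ^+ 2) / beta)
             * qint (m - n)) *: W (m + n + s),
      br (L m) (W n) = ((nu1 * delta m + gamma) * qint (m - n)) *: W (m + n + s),
      br (W m) (L n) = ((nu2 * delta m + beta) * qint (m - n)) *: L (m + n + s)
        + ((nu4 * delta m + theta - gamma) * qint (m - n)) *: W (m + n + s)
    & br (W m) (W n) = ((nu2 * delta m + beta) * qint (m - n)) *: W (m + n + s)].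

End W22.

Arguments L {K} n.
Arguments W {K} n.

(* Main.v *)
Require Import Defs.
From mathcomp Require Import all_boot all_order all_algebra.
From mathcomp Require Import finmap ring.
From mathcomp.multinomials Require Import monalg.

Import GRing.Theory.
Local Open Scope ring_scope.

(** The argument has an abstract half and a computational half.

    Abstractly, an averaging operator P turns any Hom-Leibniz bracket into
    another one, {x, y} = [P x, y]: commuting with alpha and the identity
    [P x, P y] = P [P x, y] rewrite the Hom-Leibniz identity of { , } at
    (x, y, z) into that of [ , ] at (P x, P y, z)
    ([averaging_Leibniz]).  Hence it is enough that W^q itself is Hom-Leibniz.
    Being trilinear, this only has to be seen on basis vectors, where it is the
    q-analogue [qint_Jacobi] of the Jacobi identity of the Witt algebra
    ([Wq_Leibniz]).

    The bracket [P x, y] computed from an operator of degree d lands in degree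
    m + n + d, whereas the multiplication tables may also be read in degree
    m + n.  The two readings differ by the shift T : L_m |-> L_(m-d),
    W_m |-> W_(m-d).  Since q^d = 1, the numbers [m - n], the eigenvalues of
    alpha and the coefficients of P do not see a translation by d, so T lies in
    the centroid of W^q and commutes with alpha and P.  Composing an averaging
    operator with such a T gives an averaging operator ([averaging_centroid]),
    namely the operator of degree 0 with the same coefficients, and the
    unshifted table is the bracket that it defines.

    The five families are instances of one statement about arbitrary d-periodic
    coefficients, [basis_op_Leibniz]. *)

(** * Unbundled linear maps *)

Lemma linear_fun0 (K : fieldType) (A B : lmodType K) (f : A -> B) :
  linear f -> f 0 = 0.
Proof. by move/(_ (-1) 0 0); rewrite scaler0 addr0 scaleN1r addNr. Qed.

Arguments linear_fun0 {K A B f}.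

Lemma linear_funZ (K : fieldType) (A B : lmodType K) (f : A -> B) :
  linear f -> forall a x, f (a *: x) = a *: f x.
Proof.
by move=> fL a x; have := fL a x 0; rewrite (linear_fun0 fL) !addr0.
Qed.

Arguments linear_funZ {K A B f}.

Lemma scale_combination (K : fieldType) (A : lmodType K) (x y a b c e : K)
    (u v : A) :
  x *: (a *: u + b *: v) + y *: (c *: u + e *: v) =
  (x * a + y * c) *: u + (x * b + y * e) *: v.
Proof. by rewrite !scalerDr !scalerA addrACA -!scalerDl. Qed.

(** * Averaging operators on Hom-Leibniz algebras *)

Section Averaging.
Set Implicit Arguments. Unset Strict Implicit.
Variables (K : fieldType) (A : lmodType K).
Implicit Types (br : A -> A -> A) (alpha P T : A -> A).

Lemma averaging_Leibniz br alpha P :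
  hom_Leibniz_algebra br alpha -> averaging_operator br alpha P ->
  hom_Leibniz_algebra (fun x y => br (P x) y) alpha.
Proof.
move=> [[brl brr alphaL] Leib] [PL alphaP PPl _]; split.
  by split=> // y a u v; rewrite PL brl.
by move=> x y z; rewrite -!alphaP Leib -PPl.
Qed.

(** All that matters about T is that it may be moved freely through the
    bracket, alpha and P; then both sides of each averaging identity for T P
    are T (T _) applied to the corresponding side for P. *)
Lemma averaging_centroid br alpha P T :
  linear T -> (forall x, alpha (T x) = T (alpha x)) ->
  (forall x y, br (T x) y = T (br x y)) ->
  (forall x y, br x (T y) = T (br x y)) ->
  (forall x, T (P x) = P (T x)) ->
  averaging_operator br alpha P ->
  averaging_operator br alpha (fun x => T (P x)).
Proof.
move=> TL alphaT Tl Tr TP [PL alphaP PPl PPr]; split.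
- by move=> a u v; rewrite PL TL.
- by move=> x; rewrite alphaT alphaP.
- by move=> x y; rewrite !(Tl, Tr) PPl -TP.
- by move=> x y; rewrite !(Tl, Tr) PPr -TP.
Qed.

Lemma eq_hom_Leibniz br br' alpha :
  (forall x y, br x y = br' x y) ->
  hom_Leibniz_algebra br' alpha -> hom_Leibniz_algebra br alpha.
Proof.
move=> E [[brl brr alphaL] Leib]; split.
  by split=> // y a u v; rewrite !E ?brl ?brr.
by move=> x y z; rewrite !E Leib.
Qed.

End Averaging.

(** * Linear extension from the basis L_n, W_n *)

Section Basis.
Set Implicit Arguments. Unset Strict Implicit.
Variable K : fieldType.
Local Notation V := (Wspace K).

Definition Wbasis (k : Windex) : V :=
  match k with inl n => L n | inr n => W n end.

Lemma WbasisE k : Wbasis k = << k >>.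
Proof. by case: k. Qed.

(** Enlarging the range of summation puts sums over the supports of u, v and
    a u + v on a common index set. *)
Lemma lin_extEw (f : Windex -> V) (x : V) (D : {fset Windex}) :
  (msupp x `<=` D)%fset -> lin_ext f x = \sum_(k <- D) x@_k *: f k.
Proof.
move=> sxD; apply: big_fset_incl => // k _ /mcoeff_outdom ->.
by rewrite scale0r.
Qed.

Lemma lin_ext_linear (f : Windex -> V) : linear (lin_ext f).
Proof.
move=> a u v; set D := (msupp u `|` msupp v)%fset.
have sD : (msupp (a *: u + v) `<=` D)%fset.
  apply: fsubset_trans (msuppD_le _ _) _.
  by apply: fsetSU; apply: msuppZ_le.
rewrite (lin_extEw f sD) (lin_extEw f (fsubsetUl _ _ : (msupp u `<=` D)%fset)).
rewrite (lin_extEw f (fsubsetUr _ _ : (msupp v `<=` D)%fset)).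
rewrite scaler_sumr -big_split /=; apply: eq_bigr => k _.
by rewrite mcoeffD mcoeffZ scalerDl scalerA.
Qed.

Lemma lin_ext_basis (f : Windex -> V) k : lin_ext f (Wbasis k) = f k.
Proof.
rewrite WbasisE (lin_extEw f (msuppU_le : (_ `<=` [fset k])%fset)).
by rewrite big_seq_fset1 mcoeffU eqxx scale1r.
Qed.

Lemma linear_basis_ext (f g : V -> V) : linear f -> linear g ->
  (forall k, f (Wbasis k) = g (Wbasis k)) -> f =1 g.
Proof.
move=> fL gL efg x.
have [f0 g0] := (linear_fun0 fL, linear_fun0 gL).
rewrite (monalgE x); elim/big_rec: _ => [|k y _ IH]; first by rewrite f0 g0.
have -> : << x@_k *g k >> = x@_k *: (Wbasis k : {malg K[Windex]}).
  by apply/malgP => l; rewrite WbasisE mcoeffZ !mcoeffU mulr_natr.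
by rewrite fL gL IH efg.
Qed.

Lemma bilinear_basis_ext (b b' : V -> V -> V) :
  (forall y, linear (fun x => b x y)) -> (forall x, linear (b x)) ->
  (forall y, linear (fun x => b' x y)) -> (forall x, linear (b' x)) ->
  (forall k l, b (Wbasis k) (Wbasis l) = b' (Wbasis k) (Wbasis l)) ->
  forall x y, b x y = b' x y.
Proof.
move=> bl br b'l b'r E x y.
apply: (linear_basis_ext (bl y) (b'l y)) => k.
exact: (linear_basis_ext (br _) (b'r _)) => l.
Qed.

Lemma Leibniz_basis_ext (br : V -> V -> V) (alpha : V -> V) :
  hom_algebra br alpha ->
  (forall k l p, let x := Wbasis k in let y := Wbasis l in let z := Wbasis p in
     br (alpha x) (br y z) = br (br x y) (alpha z) + br (alpha y) (br x z)) ->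
  hom_Leibniz_algebra br alpha.
Proof.
move=> [brl brr aL] E; split=> // x y z; move: x.
apply: linear_basis_ext => [a u v|a u v|k].
- by rewrite aL brl.
- by rewrite !(brl, brr) scalerDr addrACA.
move: y; apply: linear_basis_ext => [a u v|a u v|l].
- by rewrite brl brr.
- by rewrite aL brr !brl scalerDr addrACA.
move: z; apply: linear_basis_ext => [a u v|a u v|p].
- by rewrite !brr.
- by rewrite aL !brr scalerDr addrACA.
exact: E.
Qed.

End Basis.

(** * The Hom-Leibniz identity in W^q *)

Section Wq.
Set Implicit Arguments. Unset Strict Implicit.
Variables (K : fieldType) (q : K).
Hypothesis q0 : q != 0.
Local Notation V := (Wspace K).
Local Notation br := (Wbracket q).
Local Notation alpha := (Walpha q).

Lemma qintN n : qint q (- n) = - qint q n.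
Proof. by rewrite /qint opprK -mulNr opprB. Qed.

Lemma Wbracket_linearl y : linear (fun x => br x y).
Proof. exact: lin_ext_linear. Qed.

Lemma Wbracket_linearr x : linear (br x).
Proof.
move=> a u v; rewrite /Wbracket /bilin_ext.
rewrite !(lin_extEw _ (fsubset_refl (msupp x))).
rewrite scaler_sumr -big_split; apply: eq_bigr => k _.
by rewrite lin_ext_linear scalerDr !scalerA mulrC.
Qed.

Lemma Walpha_linear : linear alpha.
Proof. exact: lin_ext_linear. Qed.

Lemma Wbracket_basisE k l : br (Wbasis K k) (Wbasis K l) = Wbracket_basis q k l.
Proof. by rewrite /Wbracket /bilin_ext !lin_ext_basis. Qed.

Lemma WbracketLL m n : br (L m) (L n) = qint q (m - n) *: L (m + n).
Proof. exact: Wbracket_basisE (inl m) (inl n). Qed.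

Lemma WbracketLW m n : br (L m) (W n) = qint q (m - n) *: W (m + n).
Proof. exact: (Wbracket_basisE (inl m) (inr n)). Qed.

Lemma WbracketWL m n : br (W m) (L n) = qint q (m - n) *: W (m + n).
Proof.
rewrite (Wbracket_basisE (inr m) (inl n)) /=.
by rewrite -scaleNr -qintN opprB (addrC n).
Qed.

Lemma WbracketWW m n : br (W m) (W n) = 0.
Proof. exact: (Wbracket_basisE (inr m) (inr n)). Qed.

Lemma WalphaL n : alpha (L n) = (q ^ n + q ^ (- n)) *: L n.
Proof. exact: (lin_ext_basis _ (inl n)). Qed.

Lemma WalphaW n : alpha (W n) = (q ^ n + q ^ (- n)) *: W n.
Proof. exact: (lin_ext_basis _ (inr n)). Qed.

(** The coefficient form of the Hom-Jacobi identity for L_l, L_m, L_n, with two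
    of the three cyclic terms moved to the right.  The cyclic sum vanishes
    because (q^l + q^-l) (q - q^-1)^2 [m - n] [l - m - n] equals
    f l n - f l m + g n - g m, where f l n = q^(2l-2n) + q^(2n-2l) is symmetric
    and g n = q^(2n) + q^(-2n). *)
Lemma qint_Jacobi l m n :
  (q ^ l + q ^ (- l)) * qint q (m - n) * qint q (l - (m + n)) =
  (q ^ n + q ^ (- n)) * qint q (l - m) * qint q (l + m - n)
  + (q ^ m + q ^ (- m)) * qint q (l - n) * qint q (m - (l + n)).
Proof.
(* Every term contains the normalisation twice, so its value is irrelevant. *)
rewrite /qint; move: (q - q^-1)^-1 => c.
rewrite !(opprD, opprK) !(expfzDr _ _ q0) -!invr_expz.
have [ql qm qn] : [/\ q ^ l != 0, q ^ m != 0 & q ^ n != 0].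
  by rewrite !expfz_neq0.
by move: (q ^ l) (q ^ m) (q ^ n) ql qm qn => x y z *; field; apply/and3P.
Qed.

(** If at least two of the three arguments are W's, all terms vanish; otherwise
    the three terms are multiples of one basis vector and [qint_Jacobi] compares
    them.  Only the multiplication rules enter, so the basis is replaced by an
    arbitrary family x in an arbitrary module. *)
Lemma Leibniz_on_basis (A : lmodType K) (b : A -> A -> A) (al : A -> A)
    (x : Windex -> A) :
  (forall y, linear (fun x => b x y)) -> (forall x, linear (b x)) ->
  (forall m, al (x (inl m)) = (q ^ m + q ^ (- m)) *: x (inl m)) ->
  (forall m, al (x (inr m)) = (q ^ m + q ^ (- m)) *: x (inr m)) ->
  (forall m n, b (x (inl m)) (x (inl n)) = qint q (m - n) *: x (inl (m + n))) ->
  (forall m n, b (x (inl m)) (x (inr n)) = qint q (m - n) *: x (inr (m + n))) ->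
  (forall m n, b (x (inr m)) (x (inl n)) = qint q (m - n) *: x (inr (m + n))) ->
  (forall m n, b (x (inr m)) (x (inr n)) = 0) ->
  forall k l p, b (al (x k)) (b (x l) (x p)) =
    b (b (x k) (x l)) (al (x p)) + b (al (x l)) (b (x k) (x p)).
Proof.
move=> bl br alL alW LL LW WL WW.
have b0l y : b 0 y = 0 by exact: linear_fun0 (bl y).
have b0r y : b y 0 = 0 by exact: linear_fun0 (br y).
have bZl a y z : b (a *: y) z = a *: b y z by exact: linear_funZ (bl z) a y.
have bZr a y z : b y (a *: z) = a *: b y z by exact: linear_funZ (br y) a z.
case=> l [] m [] n;
  rewrite ?(alL, alW) ?(bZl, bZr) !(LL, LW, WL, WW)
          ?(bZl, bZr, b0l, b0r, LL, LW, WL, WW) ?scaler0 ?addr0 // !scalerA;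
  by rewrite -(addrA l m n) (addrCA m l n) qint_Jacobi scalerDl.
Qed.

Lemma Wq_Leibniz : hom_Leibniz_algebra br alpha.
Proof.
apply: Leibniz_basis_ext.
  split; [exact: Wbracket_linearl|exact: Wbracket_linearr|exact: Walpha_linear].
apply: Leibniz_on_basis.
- exact: Wbracket_linearl.
- exact: Wbracket_linearr.
- exact: WalphaL.
- exact: WalphaW.
- exact: WbracketLL.
- exact: WbracketLW.
- exact: WbracketWL.
- exact: WbracketWW.
Qed.

(** * Translation of degrees by a period of q *)

Lemma expq_period s n : q ^ s = 1 -> q ^ (n + s) = q ^ n.
Proof. by move=> qs; rewrite expfzDr // qs mulr1. Qed.

Lemma expqN_period s n : q ^ s = 1 -> q ^ (- (n + s)) = q ^ (- n).
Proof. by move=> qs; rewrite -!invr_expz expq_period. Qed.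

Lemma qint_period s n : q ^ s = 1 -> qint q (n + s) = qint q n.
Proof. by move=> qs; rewrite /qint expq_period ?expqN_period. Qed.

Lemma delta_period s m : q ^ s = 1 -> delta q (m + s) = delta q m.
Proof.
by move=> qs; rewrite /delta ![2 * _]mulrC -!exprz_exp expq_period.
Qed.

Definition shift s : V -> V :=
  basis_op s (fun=> 1) (fun=> 0) (fun=> 0) (fun=> 1).

Lemma basis_op_linear s (a b c e : int -> K) : linear (basis_op s a b c e).
Proof. exact: lin_ext_linear. Qed.

Lemma basis_opL s (a b c e : int -> K) m :
  basis_op s a b c e (L m) = a m *: L (m + s) + b m *: W (m + s).
Proof. exact: (lin_ext_basis _ (inl m)). Qed.

Lemma basis_opW s (a b c e : int -> K) m :
  basis_op s a b c e (W m) = c m *: L (m + s) + e m *: W (m + s).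
Proof. exact: (lin_ext_basis _ (inr m)). Qed.

Lemma shiftL s m : shift s (L m) = L (m + s).
Proof. by rewrite /shift basis_opL scale1r scale0r addr0. Qed.

Lemma shiftW s m : shift s (W m) = W (m + s).
Proof. by rewrite /shift basis_opW scale1r scale0r add0r. Qed.

Lemma shift_linear s : linear (shift s).
Proof. exact: basis_op_linear. Qed.

Lemma shift_scale s a x : shift s (a *: x) = a *: shift s x.
Proof. exact: linear_funZ (@shift_linear s) a x. Qed.

Lemma shift_comp_basis_op s d (a b c e : int -> K) x :
  shift s (basis_op d a b c e x) = basis_op (d + s) a b c e x.
Proof.
move: x; apply: linear_basis_ext => [a' u v|a' u v|[] m /=].
- by rewrite basis_op_linear shift_linear.
- exact: basis_op_linear.
- by rewrite !basis_opL shift_linear shift_scale shiftL shiftW addrA.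
- by rewrite !basis_opW shift_linear shift_scale shiftL shiftW addrA.
Qed.

Lemma basis_op_comp_shift s d (a b c e : int -> K) x :
  (forall m, a (m + s) = a m) -> (forall m, b (m + s) = b m) ->
  (forall m, c (m + s) = c m) -> (forall m, e (m + s) = e m) ->
  basis_op d a b c e (shift s x) = basis_op (d + s) a b c e x.
Proof.
move=> sa sb sc se; move: x.
apply: linear_basis_ext => [a' u v|a' u v|[] m /=].
- by rewrite shift_linear basis_op_linear.
- exact: basis_op_linear.
- by rewrite shiftL !basis_opL sa sb addrAC addrA.
- by rewrite shiftW !basis_opW sc se addrAC addrA.
Qed.

Lemma Walpha_shift s x : q ^ s = 1 -> alpha (shift s x) = shift s (alpha x).
Proof.
move=> qs; move: x; apply: linear_basis_ext => [a u v|a u v|[] m /=].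
- by rewrite shift_linear Walpha_linear.
- by rewrite Walpha_linear shift_linear.
- by rewrite shiftL !WalphaL shift_scale shiftL expq_period ?expqN_period.
- by rewrite shiftW !WalphaW shift_scale shiftW expq_period ?expqN_period.
Qed.

Lemma Wbracket_shiftl s x y :
  q ^ s = 1 -> br (shift s x) y = shift s (br x y).
Proof.
move=> qs; move: x y.
apply: bilinear_basis_ext => [y a u v|x a u v|y a u v|x a u v|].
- by rewrite shift_linear Wbracket_linearl.
- exact: Wbracket_linearr.
- by rewrite Wbracket_linearl shift_linear.
- by rewrite Wbracket_linearr shift_linear.
have E (m n : int) : qint q (m + s - n) = qint q (m - n).
  by rewrite addrAC (qint_period _ qs).
case=> m [] n /=.
- by rewrite shiftL !WbracketLL E shift_scale shiftL addrAC.
- by rewrite shiftL !WbracketLW E shift_scale shiftW addrAC.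
- by rewrite shiftW !WbracketWL E shift_scale shiftW addrAC.
- by rewrite shiftW !WbracketWW (linear_fun0 (@shift_linear s)).
Qed.

Lemma Wbracket_shiftr s x y :
  q ^ s = 1 -> br x (shift s y) = shift s (br x y).
Proof.
move=> qs; move: x y.
apply: bilinear_basis_ext => [y a u v|x a u v|y a u v|x a u v|].
- exact: Wbracket_linearl.
- by rewrite shift_linear Wbracket_linearr.
- by rewrite Wbracket_linearl shift_linear.
- by rewrite Wbracket_linearr shift_linear.
have E (m n : int) : qint q (m - (n + s)) = qint q (m - n).
  by rewrite opprD addrA -(qint_period (m - n - s) qs) subrK.
case=> m [] n /=.
- by rewrite shiftL !WbracketLL E shift_scale shiftL addrA.
- by rewrite shiftW !WbracketLW E shift_scale shiftW addrA.
- by rewrite shiftL !WbracketWL E shift_scale shiftW addrA.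
- by rewrite shiftW !WbracketWW (linear_fun0 (@shift_linear s)).
Qed.

(** * The brackets [P x, y] *)

(** The common shape of the five multiplication tables: each of them is the
    instance given by the coefficients of the corresponding operator. *)
Definition op_table (a b c e : int -> K) s (br' : V -> V -> V) : Prop :=
  forall m n : int,
  [/\ br' (L m) (L n) = (a m * qint q (m - n)) *: L (m + n + s)
                        + (b m * qint q (m - n)) *: W (m + n + s),
      br' (L m) (W n) = (a m * qint q (m - n)) *: W (m + n + s),
      br' (W m) (L n) = (c m * qint q (m - n)) *: L (m + n + s)
                        + (e m * qint q (m - n)) *: W (m + n + s)
    & br' (W m) (W n) = (c m * qint q (m - n)) *: W (m + n + s)].

Lemma basis_op_homogeneous d (a b c e : int -> K) :
  homogeneous d (basis_op d a b c e).
Proof.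
move=> m _ [x [y ->]].
exists (x * a m + y * c m), (x * b m + y * e m).
rewrite basis_op_linear (linear_funZ (@basis_op_linear d a b c e)).
by rewrite basis_opL basis_opW scale_combination.
Qed.

Lemma basis_op_table d (a b c e : int -> K) : q ^ d = 1 ->
  op_table a b c e d (fun x y => br (basis_op d a b c e x) y).
Proof.
move=> qd m n.
have brZ k x y : br (k *: x) y = k *: br x y.
  exact: linear_funZ (Wbracket_linearl y) k x.
have E : qint q (m + d - n) = qint q (m - n).
  by rewrite addrAC (qint_period _ qd).
split.
- by rewrite basis_opL Wbracket_linearl brZ WbracketLL WbracketWL E !scalerA
             [m + d + n]addrAC.
- by rewrite basis_opL Wbracket_linearl brZ WbracketLW WbracketWW E scaler0 addr0
             scalerA [m + d + n]addrAC.
- by rewrite basis_opW Wbracket_linearl brZ WbracketLL WbracketWL E !scalerA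
             [m + d + n]addrAC.
- by rewrite basis_opW Wbracket_linearl brZ WbracketLW WbracketWW E scaler0 addr0
             scalerA [m + d + n]addrAC.
Qed.

(** A table determines its bilinear bracket, so the unshifted table is that
    of the degree 0 operator, which is the degree d one followed by the shift
    by - d. *)
Lemma basis_op_Leibniz d (a b c e : int -> K) : q ^ d = 1 ->
  (forall m, a (m - d) = a m) -> (forall m, b (m - d) = b m) ->
  (forall m, c (m - d) = c m) -> (forall m, e (m - d) = e m) ->
  let P := basis_op d a b c e in
  let brP x y := br (P x) y in
  [/\ homogeneous d P,
      op_table a b c e d brP
    & averaging_operator br alpha P ->
      hom_Leibniz_algebra brP alpha /\
      (forall br0 : V -> V -> V, hom_algebra br0 alpha ->
       op_table a b c e 0 br0 -> hom_Leibniz_algebra br0 alpha)].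
Proof.
move=> qd ad bd cd ed P brP.
split; [exact: basis_op_homogeneous|exact: basis_op_table|move=> avP].
split=> [|br0 [br0l br0r _] tab0].
  exact: averaging_Leibniz Wq_Leibniz avP.
have qNd : q ^ (- d) = 1 by rewrite -invr_expz qd invr1.
pose P0 := basis_op 0 a b c e.
have P0E x : P0 x = shift (- d) (P x) by rewrite shift_comp_basis_op subrr.
have avP0 : averaging_operator br alpha (fun x => shift (- d) (P x)).
  apply: averaging_centroid avP => [|x|x y|x y|x].
  - exact: shift_linear.
  - exact: Walpha_shift.
  - exact: Wbracket_shiftl.
  - exact: Wbracket_shiftr.
  - rewrite (shift_comp_basis_op (- d) d a b c e x).
    exact: esym (basis_op_comp_shift d x ad bd cd ed).
apply: (eq_hom_Leibniz _ (averaging_Leibniz Wq_Leibniz avP0)).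
apply: bilinear_basis_ext => [//|//|y u' u v|x|k l].
- by rewrite -!P0E /P0 basis_op_linear Wbracket_linearl.
- exact: Wbracket_linearr.
rewrite -P0E.
have tabP0 := basis_op_table a b c e (expr0z q).
case: k l => m [] n; have [LL LW WL WW] := tab0 m n;
  have [LL' LW' WL' WW'] := tabP0 m n.
- exact: etrans LL (esym LL').
- exact: etrans LW (esym LW').
- exact: etrans WL (esym WL').
- exact: etrans WW (esym WW').
Qed.

End Wq.

Theorem theorem4p7 (K : fieldType) (charK : [pchar K] =i pred0)
    (q : K) (q_neq0 : q != 0) (q_neqN1 : q != -1) (q_neq1 : q != 1)
    (d : int) (qd : q ^ d = 1)
    (nu1 nu2 nu3 nu4 gamma theta beta : K) (beta_neq0 : beta != 0) :
  (let P := P1 q nu1 nu2 nu3 nu4 gamma d in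
   let br x y := Wbracket q (P x) y in
   [/\ homogeneous d P,
       table1 q nu1 nu2 nu3 nu4 gamma d br
     & averaging_operator (Wbracket q) (Walpha q) P ->
       hom_Leibniz_algebra br (Walpha q) /\
       (forall br0 : Wspace K -> Wspace K -> Wspace K,
          hom_algebra br0 (Walpha q) ->
          table1 q nu1 nu2 nu3 nu4 gamma 0 br0 ->
          hom_Leibniz_algebra br0 (Walpha q))]) /\
  (let P := P2 q nu1 nu2 nu3 nu4 beta gamma d in
   let br x y := Wbracket q (P x) y in
   [/\ homogeneous d P,
       table2 q nu1 nu2 nu3 nu4 beta gamma d br
     & averaging_operator (Wbracket q) (Walpha q) P ->
       hom_Leibniz_algebra br (Walpha q) /\
       (forall br0 : Wspace K -> Wspace K -> Wspace K,
          hom_algebra br0 (Walpha q) ->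
          table2 q nu1 nu2 nu3 nu4 beta gamma 0 br0 ->
          hom_Leibniz_algebra br0 (Walpha q))]) /\
  (let P := P3 q nu1 nu2 nu3 nu4 beta d in
   let br x y := Wbracket q (P x) y in
   [/\ homogeneous d P,
       table3 q nu1 nu2 nu3 nu4 beta d br
     & averaging_operator (Wbracket q) (Walpha q) P ->
       hom_Leibniz_algebra br (Walpha q) /\
       (forall br0 : Wspace K -> Wspace K -> Wspace K,
          hom_algebra br0 (Walpha q) ->
          table3 q nu1 nu2 nu3 nu4 beta 0 br0 ->
          hom_Leibniz_algebra br0 (Walpha q))]) /\
  (let P := P4 q nu1 nu2 nu3 nu4 beta gamma d in
   let br x y := Wbracket q (P x) y in
   [/\ homogeneous d P,
       table4 q nu1 nu2 nu3 nu4 beta gamma d br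
     & averaging_operator (Wbracket q) (Walpha q) P ->
       hom_Leibniz_algebra br (Walpha q) /\
       (forall br0 : Wspace K -> Wspace K -> Wspace K,
          hom_algebra br0 (Walpha q) ->
          table4 q nu1 nu2 nu3 nu4 beta gamma 0 br0 ->
          hom_Leibniz_algebra br0 (Walpha q))]) /\
  (let P := P5 q nu1 nu2 nu3 nu4 beta gamma theta d in
   let br x y := Wbracket q (P x) y in
   [/\ homogeneous d P,
       table5 q nu1 nu2 nu3 nu4 beta gamma theta d br
     & averaging_operator (Wbracket q) (Walpha q) P ->
       hom_Leibniz_algebra br (Walpha q) /\
       (forall br0 : Wspace K -> Wspace K -> Wspace K,
          hom_algebra br0 (Walpha q) ->
          table5 q nu1 nu2 nu3 nu4 beta gamma theta 0 br0 ->
          hom_Leibniz_algebra br0 (Walpha q))]).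

Proof.
have qNd : q ^ (- d) = 1 by rewrite -invr_expz qd invr1.
have D m : delta q (m - d) = delta q m by exact: delta_period.
split; [|split; [|split; [|split]]];
  by apply: basis_op_Leibniz => // m; rewrite D.
Qed.
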